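(* Deformations of minimal Lagrangian tori in $\mathbb{C}P^2$ given by the Novikov–Veselov hierarchy preserve the area of the tori. That is, if $\Sigma\subset\mathbb{C}P^2$ is a minimal Lagrangian torus with lift $r:\mathbb{R}^2\to S^5$, and $\tilde r(t):\mathbb{R}^2\to S^5$, $t=(t_2,t_3,\dots)$, $\tilde r(0)=r$, is a Novikov–Veselov deformation of $r$ (as defined in the context), defining minimal Lagrangian tori $\Sigma_t\subset\mathbb{C}P^2$ with $\Sigma_0=\Sigma$, then $\mathrm{Area}(\Sigma_t)=\mathrm{Area}(\Sigma)$ for all $t$.
   Context: $\mathbb{C}P^2$ carries the Fubini–Study metric for which the Hopf projection $\mathcal{H}:S^5\to\mathbb{C}P^2$ from the unit sphere $S^5\subset\mathbb{C}^3$ is a Riemannian submersion. $\langle\cdot,\cdot\rangle$ is the Hermitian inner product of $\mathbb{C}^3$; $\Delta=\partial_x^2+\partial_y^2$, $z=x+iy$. Let $\Sigma\subset\mathbb{C}P^2$ be an (immersed) minimal Lagrangian torus. There are conformal coordinates $x,y$ on its universal cover in which the induced metric is $ds^2=2e^{v}(dx^2+dy^2)$ with $v$ satisfying the Tzitzéica equation $\Delta v=4(e^{-2v}-e^{v})$. A lift map $r:\mathbb{R}^2\to S^5$ of $\Sigma$ is a horizontal lift of the immersion: $\mathcal{H}\circ r$ is the immersion (doubly periodic with respect to a lattice $\Lambda$), $\langle r,r\rangle=1$, $\langle r_x,r\rangle=\langle r_y,r\rangle=\langle r_x,r_y\rangle=0$, $\langle r_x,r_x\rangle=\langle r_y,r_y\rangle=2e^v$.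 A Novikov–Veselov deformation of $r$ is a smooth family of lift maps $\tilde r(t):\mathbb{R}^2\to S^5$, depending on times $t=(t_2,t_3,\dots)$ (finitely many of which are nonzero), with $\tilde r(0)=r$, such that: (i) each $\tilde r(t)$ defines a minimal Lagrangian torus $\Sigma_t$ with induced metric $2e^{\tilde v(x,y,t)}(dx^2+dy^2)$, $\tilde v(0)=v$, and the conformal type of the torus is preserved (for every $t$ the torus with the metric induced by $\Sigma_t$ is conformally equivalent to that of $\Sigma_0$); (ii) $L\tilde r=0$ with $L=\Delta+4e^{\tilde v}$, and $\partial_{t_n}\tilde r=A_n\tilde r$, where $A_n$ are differential operators of order $2n+1$ in $x,y$ of the form $$A_n=\partial_z^{2n+1}+u_{2n-1}\partial_z^{2n-1}+\cdots+u_1\partial_z+\partial_{\bar z}^{2n+1}+w_{2n-1}\partial_{\bar z}^{2n-1}+\cdots+w_1\partial_{\bar z}$$ with coefficients $u_j,w_j$ functions of $z,\bar z$ (and $t$); (iii) $\tilde V=4e^{\tilde v}$ satisfies the Novikov–Veselov hierarchy, i.e. $\partial L/\partial t_n=[A_n,L]+B_nL$ for some differential operators $B_n$ of order $2n-2$; (iv) the spectral curve of $L$ (the Riemann surface parametrizing the Bloch solutions of $L\psi=0$, obtained from the set of their Floquet multiplier pairs along a basis of $\Lambda$) does not depend on $t$. *)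

(* Defs.v *)
From Stdlib Require Export Reals ZArith List.
From Coquelicot Require Export Coquelicot.

Open Scope R_scope.

(** * Smooth functions of finitely supported sequences

    A sequence [p : nat -> R] encodes the point [x = p 0], [y = p 1] of the
    plane together with the times [t_n = p n], [n >= 2].  Only finitely
    supported sequences matter; values elsewhere are ignored. *)

Definition fin_supp (p : nat -> R) : Prop :=
  exists N, forall n, (N <= n)%nat -> p n = 0.

Definition upd (p : nat -> R) (n : nat) (s : R) : nat -> R :=
  fun m => if Nat.eqb m n then s else p m.

Definition partial (n : nat) (f : (nat -> R) -> R) : (nat -> R) -> R :=
  fun p => Derive (fun s => f (upd p n s)) (p n).

(** Continuity on each finite-dimensional subspace [R^N]. *)
Definition continuous_fin (f : (nat -> R) -> R) : Prop :=
  forall (N : nat) (p : nat -> R), (forall n, (N <= n)%nat -> p n = 0) ->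
  forall eps, 0 < eps -> exists delta, 0 < delta /\
  forall q : nat -> R, (forall n, (N <= n)%nat -> q n = 0) ->
    (forall n, (n < N)%nat -> Rabs (q n - p n) < delta) ->
    Rabs (f q - f p) < eps.

Definition smooth (f : (nat -> R) -> R) : Prop :=
  forall l : list nat,
    let g := fold_right partial f l in
    continuous_fin g /\
    (forall n p, fin_supp p -> ex_derive (fun s => g (upd p n s)) (p n)).

Definition smooth2 (f : R -> R -> R) : Prop :=
  smooth (fun p => f (p 0%nat) (p 1%nat)).

Definition smooth2C (f : R -> R -> C) : Prop :=
  smooth2 (fun x y => Re (f x y)) /\ smooth2 (fun x y => Im (f x y)).

(** The times [t = (t_2, t_3, ...)], indexed from 2. *)
Definition times (t : nat -> R) : Prop :=
  t 0%nat = 0 /\ t 1%nat = 0 /\ fin_supp t.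

Definition time0 : nat -> R := fun _ => 0.

Definition times_of (p : nat -> R) : nat -> R :=
  fun n => if Nat.ltb n 2 then 0 else p n.

Definition smooth_in_time (F : (nat -> R) -> R) : Prop :=
  smooth (fun p => F (times_of p)).

Definition smooth_family (F : (nat -> R) -> R -> R -> R) : Prop :=
  smooth (fun p => F (times_of p) (p 0%nat) (p 1%nat)).

Definition smooth_familyC (F : (nat -> R) -> R -> R -> C) : Prop :=
  smooth_family (fun t x y => Re (F t x y)) /\
  smooth_family (fun t x y => Im (F t x y)).

(** * Differential operators in the plane, [z = x + i y] *)

Definition DeriveC (f : R -> C) (s : R) : C :=
  (Derive (fun a => Re (f a)) s, Derive (fun a => Im (f a)) s).

Definition Dx (f : R -> R -> C) : R -> R -> C :=
  fun x y => DeriveC (fun a => f a y) x.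
Definition Dy (f : R -> R -> C) : R -> R -> C :=
  fun x y => DeriveC (fun b => f x b) y.
Definition Dt (n : nat) (F : (nat -> R) -> R -> R -> C) (t : nat -> R)
  : R -> R -> C :=
  fun x y => DeriveC (fun s => F (upd t n s) x y) (t n).

Definition Dz (f : R -> R -> C) : R -> R -> C :=
  fun x y => (/ 2 * (Dx f x y - Ci * Dy f x y))%C.
Definition Dzbar (f : R -> R -> C) : R -> R -> C :=
  fun x y => (/ 2 * (Dx f x y + Ci * Dy f x y))%C.

Definition Laplacian (f : R -> R -> C) : R -> R -> C :=
  fun x y => (Dx (Dx f) x y + Dy (Dy f) x y)%C.

Definition Schrodinger (V : R -> R -> R) (f : R -> R -> C) : R -> R -> C :=
  fun x y => (Laplacian f x y + RtoC (V x y) * f x y)%C.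

Definition potential (v : R -> R -> R) : R -> R -> R :=
  fun x y => 4 * exp (v x y).

Definition Tzitzeica (v : R -> R -> R) : Prop :=
  forall x y,
    Derive_n (fun a => v a y) 2 x + Derive_n (fun b => v x b) 2 y
    = 4 * (exp (- 2 * v x y) - exp (v x y)).

(** [C] as a commutative monoid, for Coquelicot's finite sums. *)
Definition Csum (a : nat -> C) (m n : nat) : C :=
  @sum_n_m C_AbelianMonoid a m n.

(** The operator of order [2n+1] with lower-order coefficients [u j], [w j],
    [1 <= j <= 2n-1]. *)
Definition NV_op (n : nat) (u w : nat -> R -> R -> C) (f : R -> R -> C)
  : R -> R -> C :=
  fun x y =>
    (Nat.iter (2 * n + 1) Dz f x y
     + Csum (fun j => u j x y * Nat.iter j Dz f x y) 1 (2 * n - 1)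
     + Nat.iter (2 * n + 1) Dzbar f x y
     + Csum (fun j => w j x y * Nat.iter j Dzbar f x y) 1 (2 * n - 1))%C.

(** The general operator of order (at most) [m]. *)
Definition diff_op (m : nat) (b : nat -> nat -> R -> R -> C)
  (f : R -> R -> C) : R -> R -> C :=
  fun x y =>
    Csum (fun i => Csum (fun j =>
      (b i j x y * Nat.iter i Dz (Nat.iter j Dzbar f) x y)%C) 0 (m - i)) 0 m.

(** * [C^3], the Hopf projection and [CP^2] *)

Inductive idx : Set := k1 | k2 | k3.

Definition vec := idx -> C.
Definition mat := idx -> idx -> C.

Definition sum3 (a : idx -> C) : C := (a k1 + a k2 + a k3)%C.

Definition herm (a b : vec) : C := sum3 (fun k => (a k * Cconj (b k))%C).

Definition mmul (X Y : mat) : mat :=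
  fun i j => sum3 (fun k => (X i k * Y k j)%C).
Definition trace (X : mat) : C := sum3 (fun k => X k k).
Definition Hermitian (X : mat) : Prop :=
  forall i j, X i j = Cconj (X j i).

(** A complex line in [C^3] is identified with the orthogonal projector onto
    it. *)
Definition CP2 (P : mat) : Prop :=
  Hermitian P /\ (forall i j, mmul P P i j = P i j) /\ trace P = RtoC 1.

Definition hopf (r : vec) : mat := fun i j => (r i * Cconj (r j))%C.

(** The tangent space at [P], obtained by differentiating [P P = P]. *)
Definition tangent (P X : mat) : Prop :=
  Hermitian X /\ forall i j, (mmul P X i j + mmul X P i j)%C = X i j.

(** The factor [1/2] makes [hopf] a Riemannian submersion from the unit
    sphere: see [FS_hopf]. *)
Definition FS (X Y : mat) : R := / 2 * Re (trace (mmul X Y)).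

(** The complex structure of [CP^2]: it sends [u r^* + r u^*] to
    [(i u) r^* + r (i u)^*] when [u] is horizontal at [r]. *)
Definition J (P X : mat) : mat :=
  fun i j => (Ci * (mmul X P i j - mmul P X i j))%C.

Definition dhopf (r u : vec) : mat :=
  fun i j => (u i * Cconj (r j) + r i * Cconj (u j))%C.

Lemma FS_hopf (r u w : vec) :
  herm r r = RtoC 1 -> herm u r = RtoC 0 -> herm w r = RtoC 0 ->
  FS (dhopf r u) (dhopf r w) = Re (herm u w).
Proof.
intros Hr Hu Hw.
assert (Hu' : herm r u = RtoC 0).
{ apply (f_equal Cconj) in Hu. revert Hu. unfold herm, sum3.
  rewrite !Cplus_conj, !Cmult_conj, !Cconj_conj.
  intros H. rewrite (Cmult_comm (r k1)), (Cmult_comm (r k2)),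
    (Cmult_comm (r k3)), H.
  apply injective_projections; simpl; ring. }
assert (E : trace (mmul (dhopf r u) (dhopf r w))
  = (herm u w * herm r r + herm w u * herm r r
     + herm w r * herm u r + herm r u * herm r w)%C).
{ unfold trace, mmul, dhopf, herm, sum3. ring. }
unfold FS. rewrite E, Hr, Hu, Hw, Hu'.
unfold herm, sum3; simpl. field.
Qed.

(** * Immersed minimal Lagrangian tori *)

Definition mDx (f : R -> R -> mat) : R -> R -> mat :=
  fun x y i j => Dx (fun a b => f a b i j) x y.
Definition mDy (f : R -> R -> mat) : R -> R -> mat :=
  fun x y i j => Dy (fun a b => f a b i j) x y.

Definition g11 (f : R -> R -> mat) x y : R := FS (mDx f x y) (mDx f x y).
Definition g12 (f : R -> R -> mat) x y : R := FS (mDx f x y) (mDy f x y).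
Definition g22 (f : R -> R -> mat) x y : R := FS (mDy f x y) (mDy f x y).
Definition gdet (f : R -> R -> mat) x y : R :=
  g11 f x y * g22 f x y - g12 f x y * g12 f x y.

Definition Lagrangian (f : R -> R -> mat) : Prop :=
  forall x y, FS (J (f x y) (mDx f x y)) (mDy f x y) = 0.

(** Vanishing of the mean curvature vector [1/2 g^{ab} II_ab].  Since [CP^2]
    is isometrically embedded in the Hermitian matrices, the component of
    [II_ab] along a normal vector [N] tangent to [CP^2] is [FS f_ab N]; the
    trace is multiplied by [det g]. *)
Definition minimal (f : R -> R -> mat) : Prop :=
  forall x y (N : mat),
    tangent (f x y) N ->
    FS (mDx f x y) N = 0 -> FS (mDy f x y) N = 0 ->
    g22 f x y * FS (mDx (mDx f) x y) N
    - 2 * g12 f x y * FS (mDx (mDy f) x y) N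
    + g11 f x y * FS (mDy (mDy f) x y) N = 0.

Definition cross (w1 w2 : R * R) : R := fst w1 * snd w2 - snd w1 * fst w2.

Definition in_lattice (w1 w2 w : R * R) : Prop :=
  exists m n : Z,
    fst w = IZR m * fst w1 + IZR n * fst w2 /\
    snd w = IZR m * snd w1 + IZR n * snd w2.

(** The torus is [R^2 / (Z w1 + Z w2)], immersed by the doubly periodic [f]. *)
Record minimal_Lagrangian_torus (w1 w2 : R * R) (f : R -> R -> mat) : Prop := {
  mlt_basis : cross w1 w2 <> 0;
  mlt_smooth : forall i j, smooth2C (fun x y => f x y i j);
  mlt_CP2 : forall x y, CP2 (f x y);
  mlt_periodic : forall x y i j,
    f (x + fst w1) (y + snd w1) i j = f x y i j /\
    f (x + fst w2) (y + snd w2) i j = f x y i j;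
  mlt_immersion : forall x y, 0 < gdet f x y;
  mlt_Lagrangian : Lagrangian f;
  mlt_minimal : minimal f
}.

(** Riemannian area, integrated over the parallelogram spanned by [w1, w2]. *)
Definition area (w1 w2 : R * R) (f : R -> R -> mat) : R :=
  Rabs (cross w1 w2) *
  RInt (fun a => RInt (fun b =>
    sqrt (gdet f (a * fst w1 + b * fst w2) (a * snd w1 + b * snd w2))) 0 1) 0 1.

(** A conformal diffeomorphism between the tori, lifted to the plane. *)
Definition conformally_equivalent
  (w1 w2 : R * R) (f : R -> R -> mat)
  (w1' w2' : R * R) (f' : R -> R -> mat) : Prop :=
  exists (P Q : R -> R -> R * R) (lam : R -> R -> R),
    (smooth2 (fun x y => fst (P x y)) /\ smooth2 (fun x y => snd (P x y))) /\
    (smooth2 (fun x y => fst (Q x y)) /\ smooth2 (fun x y => snd (Q x y))) /\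
    (forall x y, Q (fst (P x y)) (snd (P x y)) = (x, y)) /\
    (forall x y, P (fst (Q x y)) (snd (Q x y)) = (x, y)) /\
    (forall x y a b,
       in_lattice w1 w2 (a - x, b - y) <->
       in_lattice w1' w2'
         (fst (P a b) - fst (P x y), snd (P a b) - snd (P x y))) /\
    (forall x y,
       let h := fun a b => f' (fst (P a b)) (snd (P a b)) in
       0 < lam x y /\
       g11 h x y = lam x y * g11 f x y /\
       g12 h x y = lam x y * g12 f x y /\
       g22 h x y = lam x y * g22 f x y).

(** * Lift maps *)

Definition vDx (r : R -> R -> vec) : R -> R -> vec :=
  fun x y k => Dx (fun a b => r a b k) x y.
Definition vDy (r : R -> R -> vec) : R -> R -> vec :=
  fun x y k => Dy (fun a b => r a b k) x y.

Record lift_map (f : R -> R -> mat) (v : R -> R -> R) (r : R -> R -> vec)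
  : Prop := {
  lift_smooth : forall k, smooth2C (fun x y => r x y k);
  lift_hopf : forall x y i j, hopf (r x y) i j = f x y i j;
  lift_sphere : forall x y, herm (r x y) (r x y) = RtoC 1;
  lift_x_r : forall x y, herm (vDx r x y) (r x y) = RtoC 0;
  lift_y_r : forall x y, herm (vDy r x y) (r x y) = RtoC 0;
  lift_x_y : forall x y, herm (vDx r x y) (vDy r x y) = RtoC 0;
  lift_x_x : forall x y,
    herm (vDx r x y) (vDx r x y) = RtoC (2 * exp (v x y));
  lift_y_y : forall x y,
    herm (vDy r x y) (vDy r x y) = RtoC (2 * exp (v x y))
}.

(** * Riemann surfaces *)

Section Charts.

Context {X : Type} (dom : nat -> X -> Prop) (chart : nat -> X -> C).

Definition chart_open (U : X -> Prop) : Prop :=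
  forall i, @open C_UniformSpace
    (fun z => exists p, dom i p /\ U p /\ chart i p = z).

Definition chart_holomorphic (F : X -> C) : Prop :=
  forall i p, dom i p -> exists g : C -> C,
    @locally C_UniformSpace (chart i p)
      (fun z => @ex_derive C_AbsRing C_NormedModule g z /\
         forall q, dom i q -> chart i q = z -> F q = g z).

Definition chart_compact (K : X -> Prop) : Prop :=
  forall F : (X -> Prop) -> Prop,
    (forall U, F U -> chart_open U) ->
    (forall p, K p -> exists U, F U /\ U p) ->
    exists l : list (X -> Prop),
      (forall U, In U l -> F U) /\
      (forall p, K p -> exists U, In U l /\ U p).

Definition chart_closed_discrete (D : X -> Prop) : Prop :=
  forall p, exists U, chart_open U /\ U p /\
    forall q, U q -> D q -> q = p.

End Charts.

(** One-dimensional complex manifolds, given by a countable holomorphic atlas;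
    chart domains may be empty, and connectedness is not required. *)
Record RiemannSurface : Type := {
  rs_pt :> Type;
  rs_dom : nat -> rs_pt -> Prop;
  rs_chart : nat -> rs_pt -> C;
  rs_cover : forall p, exists i, rs_dom i p;
  rs_inj : forall i p q, rs_dom i p -> rs_dom i q ->
    rs_chart i p = rs_chart i q -> p = q;
  rs_overlap : forall i, chart_open rs_dom rs_chart (rs_dom i);
  rs_transition : forall i j p, rs_dom i p -> rs_dom j p ->
    exists g : C -> C,
      @locally C_UniformSpace (rs_chart i p)
        (fun z => @ex_derive C_AbsRing C_NormedModule g z /\
           forall q, rs_dom i q -> rs_dom j q -> rs_chart i q = z ->
             rs_chart j q = g z);
  rs_Hausdorff : forall p q, p <> q -> exists U W,
    chart_open rs_dom rs_chart U /\ chart_open rs_dom rs_chart W /\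
    U p /\ W q /\ forall s, ~ (U s /\ W s)
}.

(** * Spectral curve at zero energy *)

(** [psi] is a Bloch solution of [L psi = 0] with multipliers [m1], [m2]. *)
Definition Bloch_solution (V : R -> R -> R) (w1 w2 : R * R) (m1 m2 : C)
  (psi : R -> R -> C) : Prop :=
  smooth2C psi /\
  (exists x y, psi x y <> RtoC 0) /\
  (forall x y, Schrodinger V psi x y = RtoC 0) /\
  (forall x y, psi (x + fst w1) (y + snd w1) = (m1 * psi x y)%C) /\
  (forall x y, psi (x + fst w2) (y + snd w2) = (m2 * psi x y)%C).

Definition Floquet_set (V : R -> R -> R) (w1 w2 : R * R) (m1 m2 : C) : Prop :=
  exists psi, Bloch_solution V w1 w2 m1 m2 psi.

(** [G] is the normalization of the analytic set of multiplier pairs in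
    [(C \ 0)^2]: a holomorphic map onto this set that is proper over [(C \ 0)^2]
    and injective off a closed discrete subset of [G]. *)
Definition is_spectral_curve (V : R -> R -> R) (w1 w2 : R * R)
  (G : RiemannSurface) : Prop :=
  exists mu1 mu2 : G -> C,
    chart_holomorphic (rs_dom G) (rs_chart G) mu1 /\
    chart_holomorphic (rs_dom G) (rs_chart G) mu2 /\
    (forall m1 m2, Floquet_set V w1 w2 m1 m2 <->
       exists p : G, mu1 p = m1 /\ mu2 p = m2) /\
    (forall c d, 0 < c ->
       chart_compact (rs_dom G) (rs_chart G)
         (fun p => c <= Cmod (mu1 p) <= d /\ c <= Cmod (mu2 p) <= d)) /\
    chart_closed_discrete (rs_dom G) (rs_chart G)
      (fun p => exists q : G, q <> p /\ mu1 q = mu1 p /\ mu2 q = mu2 p).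

(** * Novikov-Veselov deformations *)

(** [w1 t], [w2 t] is a basis of the period lattice of the torus [Sigma_t]
    at time [t]; the immersion of [Sigma_t] is [hopf] composed with [r t]. *)
Record NV_deformation
  (w1_0 w2_0 : R * R) (f_0 : R -> R -> mat) (v_0 : R -> R -> R)
  (r_0 : R -> R -> vec)
  (w1 w2 : (nat -> R) -> R * R) (v : (nat -> R) -> R -> R -> R)
  (r : (nat -> R) -> R -> R -> vec) : Prop := {
  nv_smooth : forall k, smooth_familyC (fun t x y => r t x y k);
  nv_smooth_basis :
    smooth_in_time (fun t => fst (w1 t)) /\
    smooth_in_time (fun t => snd (w1 t)) /\
    smooth_in_time (fun t => fst (w2 t)) /\
    smooth_in_time (fun t => snd (w2 t));
  nv_init_r : forall x y k, r time0 x y k = r_0 x y k;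
  nv_init_v : forall x y, v time0 x y = v_0 x y;
  nv_init_basis : w1 time0 = w1_0 /\ w2 time0 = w2_0;
  nv_torus : forall t, times t ->
    minimal_Lagrangian_torus (w1 t) (w2 t) (fun x y => hopf (r t x y));
  nv_lift : forall t, times t ->
    lift_map (fun x y => hopf (r t x y)) (v t) (r t);
  nv_conformal_type : forall t, times t ->
    conformally_equivalent (w1 t) (w2 t) (fun x y => hopf (r t x y))
      w1_0 w2_0 f_0;
  nv_L : forall t, times t -> forall x y k,
    Schrodinger (potential (v t)) (fun a b => r t a b k) x y = RtoC 0;
  nv_flow : forall n, (2 <= n)%nat ->
    exists u w : (nat -> R) -> nat -> R -> R -> C,
      (forall t, times t -> forall j, smooth2C (u t j) /\ smooth2C (w t j)) /\
      (forall t, times t -> forall x y k,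
         Dt n (fun s a b => r s a b k) t x y
         = NV_op n (u t) (w t) (fun a b => r t a b k) x y) /\
      (forall t, times t -> exists b : nat -> nat -> R -> R -> C,
         (forall i j, smooth2C (b i j)) /\
         forall phi, smooth2C phi -> forall x y,
           let L := Schrodinger (potential (v t)) in
           let A := NV_op n (u t) (w t) in
           let B := diff_op (2 * n - 2) b in
           (Dt n (fun s a c => RtoC (potential (v s) a c)) t x y * phi x y
            = A (L phi) x y - L (A phi) x y + B (L phi) x y)%C);
  nv_spectral_curve : exists G : RiemannSurface, forall t, times t ->
    is_spectral_curve (potential (v t)) (w1 t) (w2 t) G
}.

(* Main.v *)
Require Import Defs.
From Stdlib Require Import Lra Lia Classical ClassicalEpsilon
  FunctionalExtensionality.

(* Only the first variation of area is needed.  The lift [r] satisfies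
   [L r = 0] and [|r| = 1], so [Re <Delta r, r_s> = 0] for every variation
   [r_s], and the area density [rho = (|r_x|^2 + |r_y|^2) / 2] obeys
   [rho_s = div X] with [X = (Re <r_s, r_x>, Re <r_s, r_y>)].  The period
   lattice may move as well; pulling back to a fixed unit square turns the
   derivative of [cross(w1, w2) * rho] into the divergence of a field that is
   periodic because it only depends on the doubly periodic map [hopf r].  Hence
   the area does not change when a single time [t_n] varies, and [t] is reached
   from [0] by changing finitely many times one after the other. *)

(* [ring] does not see through Coquelicot's carrier types in [@eq]. *)
Ltac ring_R := match goal with |- ?a = ?b => change (@eq R a b); ring end.

(** * Differentiation of double integrals *)

Lemma continuous_Rplus {U : UniformSpace} (f g : U -> R) (p : U) :
  continuous f p -> continuous g p -> continuous (fun q => f q + g q) p.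
Proof. intros Hf Hg; exact (continuous_plus f g p Hf Hg). Qed.

Lemma continuous_Rminus {U : UniformSpace} (f g : U -> R) (p : U) :
  continuous f p -> continuous g p -> continuous (fun q => f q - g q) p.
Proof. intros Hf Hg; exact (continuous_minus f g p Hf Hg). Qed.

Lemma continuous_Rmult {U : UniformSpace} (f g : U -> R) (p : U) :
  continuous f p -> continuous g p -> continuous (fun q => f q * g q) p.
Proof. intros Hf Hg; exact (continuous_mult f g p Hf Hg). Qed.

Definition continuous3 (K : R -> R -> R -> R) : Prop :=
  forall s x y,
    continuous (fun q : R * (R * R) => K (fst q) (fst (snd q)) (snd (snd q)))
      (s, (x, y)).

Lemma continuous3_comp {U : UniformSpace} (K : R -> R -> R -> R)
  (f g h : U -> R) (p : U) :
  continuous3 K -> continuous f p -> continuous g p -> continuous h p ->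
  continuous (fun q => K (f q) (g q) (h q)) p.
Proof.
intros HK Hf Hg Hh.
apply (continuous_comp_2 f (fun q => (g q, h q))
  (fun a (b : R * R) => K a (fst b) (snd b)) p Hf); [|apply HK].
intros P [eps HP].
specialize (Hg _ (locally_ball (g p) eps)).
specialize (Hh _ (locally_ball (h p) eps)).
unfold filtermap in *.
generalize (filter_and _ _ Hg Hh); apply filter_imp.
intros q [H1 H2]; apply HP; split; assumption.
Qed.

Lemma continuous_fst_comp {U V W : UniformSpace} (f : U -> V * W) (p : U) :
  continuous f p -> continuous (fun q => fst (f q)) p.
Proof.
intros Hf; apply (continuous_comp f fst p Hf); destruct (f p).
apply continuous_fst.
Qed.

Lemma continuous_snd_comp {U V W : UniformSpace} (f : U -> V * W) (p : U) :
  continuous f p -> continuous (fun q => snd (f q)) p.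
Proof.
intros Hf; apply (continuous_comp f snd p Hf); destruct (f p).
apply continuous_snd.
Qed.

Lemma continuous_path_comp {U : UniformSpace} (w : R -> R) (f : U -> R) (p : U) :
  (forall s, continuous w s) -> continuous f p ->
  continuous (fun q => w (f q)) p.
Proof. intros Hw Hf; exact (continuous_comp f w p Hf (Hw _)). Qed.

(** The cases for [continuous3] functions and for paths look up hypotheses in the context, which is
    why such facts are often introduced just before a call. *)
Ltac continuity :=
  repeat match goal with
  | |- continuous (fun _ => ?c) _ => apply continuous_const
  | |- continuous (fun q => q) _ => apply continuous_id
  | |- continuous fst (_, _) => apply continuous_fst
  | |- continuous snd (_, _) => apply continuous_snd
  | |- continuous (fun q => fst _) _ => apply continuous_fst_comp
  | |- continuous (fun q => snd _) _ => apply continuous_snd_comp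
  | |- continuous (fun q => _ + _) _ => apply continuous_Rplus
  | |- continuous (fun q => _ - _) _ => apply continuous_Rminus
  | |- continuous (fun q => _ * _) _ => apply continuous_Rmult
  | H : continuous3 ?K |- continuous (fun q => ?K _ _ _) _ =>
      apply (continuous3_comp K _ _ _ _ H)
  | H : continuous3 ?K |- continuous (?K ?a ?b) _ =>
      apply (continuous3_comp K (fun _ => a) (fun _ => b) (fun q => q) _ H)
  | H : forall s, continuous ?w s |- continuous (fun q => ?w _) _ =>
      apply (continuous_path_comp w _ _ H)
  | H : forall s, continuous ?w s |- continuous ?w _ => apply H
  end.

Lemma ex_RInt_continuous_everywhere (f : R -> R) (a b : R) :
  (forall x, continuous f x) -> ex_RInt f a b.
Proof.
intros Hf; apply (ex_RInt_continuous (V := R_CompleteNormedModule)); auto.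
Qed.

(** Compactness of the interval makes the continuity at [p] uniform in [b]. The parameter space is
    arbitrary, so that one and two real parameters are covered at once. *)
Lemma continuous_RInt_param {U : UniformSpace} (K : U -> R -> R) (p : U) :
  (forall b, continuous (fun q : U * R => K (fst q) (snd q)) (p, b)) ->
  (forall q b, continuous (K q) b) ->
  continuous (fun q => RInt (K q) 0 1) p.
Proof.
intros HK Hi P [eps HP].
assert (E : forall b, exists d : posreal, forall q b', ball p d q ->
  Rabs (b' - b) < d -> Rabs (K q b' - K p b) < eps / 4).
{ intros b.
  assert (He : 0 < eps / 4) by (destruct eps; simpl; lra).
  destruct (HK b _ (locally_ball (K p b) (mkposreal _ He))) as [d Hd].
  exists d; intros q b' H1 H2; apply (Hd (q, b')); split; assumption. }
(* The compactness argument takes the radius as a function of [b], hence the choice from [E]. *)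
pose (dl := fun b => proj1_sig (constructive_indefinite_description _ (E b))).
assert (Hdl : forall b q b', ball p (dl b) q -> Rabs (b' - b) < dl b ->
  Rabs (K q b' - K p b) < eps / 4)
  by (intros b; exact (proj2_sig (constructive_indefinite_description _ (E b)))).
destruct (compactness_value_1d 0 1 dl) as [d Hd].
exists d; intros q Hq; apply HP.
change (Rabs (RInt (K q) 0 1 - RInt (K p) 0 1) < eps).
assert (X : forall q, ex_RInt (K q) 0 1)
  by (intros q'; apply ex_RInt_continuous_everywhere, Hi).
assert (EQ : RInt (K q) 0 1 - RInt (K p) 0 1
  = RInt (fun b => K q b - K p b) 0 1)
  by (symmetry; apply (RInt_minus (K q) (K p)); apply X).
rewrite EQ.
(* [K q b] and [K p b] both lie within [eps / 4] of [K p c] for some nearby [c], so the integrand is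
   bounded by [eps / 2]; the slack makes the final inequality strict. *)
apply Rle_lt_trans with ((1 - 0) * (eps / 2)); [|destruct eps; simpl; lra].
apply abs_RInt_le_const; [lra| apply (ex_RInt_minus (K q) (K p)); apply X |].
intros b Hb.
(* [compactness_value_1d] gives the centre [c] only under a double negation. *)
destruct (NNPP _ (Hd b Hb)) as [c [Hc [Hc1 Hc2]]].
assert (B1 : Rabs (K q b - K p c) < eps / 4).
{ apply (Hdl c); [eapply ball_le; eauto|exact Hc1]. }
assert (B2 : Rabs (K p b - K p c) < eps / 4).
{ apply (Hdl c); [apply ball_center|exact Hc1]. }
revert B1 B2; unfold Rabs; repeat destruct Rcase_abs; lra.
Qed.

Lemma is_derive_value (f : R -> R) (x l l' : R) :
  is_derive f x l -> l = l' -> is_derive f x l'.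
Proof. intros H <-; exact H. Qed.

Lemma RInt_is_derive (f f' : R -> R) (a b : R) :
  (forall x, is_derive f x (f' x)) -> (forall x, continuous f' x) ->
  RInt f' a b = f b - f a.
Proof.
intros Hd Hc; apply is_RInt_unique.
exact (is_RInt_derive f f' a b (fun x _ => Hd x) (fun x _ => Hc x)).
Qed.

Lemma is_derive_RInt_01 (F F' : R -> R -> R) (s : R) :
  (forall s b, is_derive (fun a => F a b) s (F' s b)) ->
  (forall s b, continuous (F s) b) ->
  (forall s b, continuous (fun q : R * R => F' (fst q) (snd q)) (s, b)) ->
  is_derive (fun a => RInt (F a) 0 1) s (RInt (F' s) 0 1).
Proof.
intros HF Hc HF'.
replace (RInt (F' s) 0 1)
  with (RInt (fun b => Derive (fun a => F a b) s) 0 1).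
2: { apply RInt_ext; intros; apply is_derive_unique, HF. }
apply is_derive_RInt_param.
- apply filter_forall; intros a b _; exists (F' a b); apply HF.
- intros b _. apply continuity_2d_pt_ext with F'.
  + intros; symmetry; apply is_derive_unique, HF.
  + apply continuity_2d_pt_filterlim, HF'.
- apply filter_forall; intros a; apply ex_RInt_continuous_everywhere, Hc.
Qed.

(** After differentiation under both integrals, [Qb] disappears in the integral over [b] by the
    fundamental theorem and periodicity. The integral of [Pa] over [b] is the derivative of that of
    [P], so it disappears in the integral over [a]. *)
Lemma is_derive_double_integral_zero (K Ks : R -> R -> R -> R)
  (P Pa Q Qb : R -> R -> R) (s : R) :
  continuous3 K -> continuous3 Ks ->
  (forall s a b, is_derive (fun s => K s a b) s (Ks s a b)) ->
  (forall a b, is_derive (fun a => P a b) a (Pa a b)) ->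
  (forall a b, is_derive (fun b => Q a b) b (Qb a b)) ->
  (forall a b, continuous (fun q : R * R => P (fst q) (snd q)) (a, b)) ->
  (forall a b, continuous (fun q : R * R => Pa (fst q) (snd q)) (a, b)) ->
  (forall a b, continuous (fun q : R * R => Qb (fst q) (snd q)) (a, b)) ->
  (forall b, P 1 b = P 0 b) -> (forall a, Q a 1 = Q a 0) ->
  (forall a b, Ks s a b = Pa a b + Qb a b) ->
  is_derive (fun s => RInt (fun a => RInt (K s a) 0 1) 0 1) s 0.
Proof.
intros HK HKs DK DP DQ CP CPa CQb PP PQ HS.
assert (C2 : forall F : R -> R -> R,
  (forall a b, continuous (fun q : R * R => F (fst q) (snd q)) (a, b)) ->
  forall a b, continuous (F a) b).
{ intros F HF a b.
  apply (continuous_comp_2 (fun _ => a) (fun b => b) F b);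
    [apply continuous_const|apply continuous_id|apply HF]. }
assert (CRInt : forall F : R -> R -> R,
  (forall a b, continuous (fun q : R * R => F (fst q) (snd q)) (a, b)) ->
  forall a, continuous (fun a => RInt (F a) 0 1) a).
{ intros F HF a; apply continuous_RInt_param; auto. }
apply is_derive_value with (RInt (fun a => RInt (Ks s a) 0 1) 0 1).
- apply (is_derive_RInt_01 (fun s a => RInt (K s a) 0 1)
    (fun s a => RInt (Ks s a) 0 1)).
  + intros s' a; apply (is_derive_RInt_01 (fun s b => K s a b)
      (fun s b => Ks s a b)); intros; [apply DK| |]; continuity.
  + intros s' a; apply CRInt; intros; continuity.
  + intros s' a.
    apply (continuous_RInt_param (fun q : R * R => Ks (fst q) (snd q)));
      intros; continuity.
- assert (I2 : forall F : R -> R -> R,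
    (forall a b, continuous (fun q : R * R => F (fst q) (snd q)) (a, b)) ->
    forall a, ex_RInt (F a) 0 1)
    by (intros F HF a; apply ex_RInt_continuous_everywhere; auto).
  assert (I1 : forall a, RInt (Ks s a) 0 1 = RInt (Pa a) 0 1).
  { intros a.
    rewrite (RInt_ext _ (fun b => Pa a b + Qb a b)) by (intros; apply HS).
    transitivity (RInt (Pa a) 0 1 + RInt (Qb a) 0 1);
      [apply (RInt_plus (Pa a) (Qb a)); apply I2; assumption|].
    rewrite (RInt_is_derive (Q a) (Qb a)), PQ by auto; ring_R. }
  rewrite (RInt_ext _ (fun a => RInt (Pa a) 0 1)) by (intros; apply I1).
  rewrite (RInt_is_derive (fun a => RInt (P a) 0 1)).
  + rewrite (RInt_ext (P 1) (P 0)) by (intros; apply PP); ring_R.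
  + intros; apply is_derive_RInt_01; auto.
  + intros; apply CRInt; auto.
Qed.

(** * Integrals over a moving lattice *)

(** The chain rule with asymmetric hypotheses: one partial derivative exists everywhere and is
    continuous at the point, the other is just a number at the point. This lets a composite function
    occupy the second variable, as in [C1_comp_diag]. *)
Lemma is_derive_comp2 (F Fx : R -> R -> R) (Fy : R) (f g : R -> R)
  (u f' g' : R) :
  (forall x y, is_derive (fun x => F x y) x (Fx x y)) ->
  is_derive (fun y => F (f u) y) (g u) Fy ->
  continuous (fun q : R * R => Fx (fst q) (snd q)) (f u, g u) ->
  is_derive f u f' -> is_derive g u g' ->
  is_derive (fun u => F (f u) (g u)) u (Fx (f u) (g u) * f' + Fy * g').
Proof.
intros HFx HFy HC Hf Hg.
apply filterdiff_ext_lin with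
  (fun y : R => plus (scal (scal y f') (Fx (f u) (g u))) (scal (scal y g') Fy)).
- apply (filterdiff_comp'_2 f g F u (fun y => scal y f') (fun y => scal y g')
    (fun a b => plus (scal a (Fx (f u) (g u))) (scal b Fy)) Hf Hg).
  apply is_derive_filterdiff; auto; apply filter_forall; intros; apply HFx.
- intros y; unfold plus, scal; simpl; unfold mult; simpl; ring_R.
Qed.

(** The derivatives are explicit arguments, so that second derivatives are named by applying the
    record again to [Fs], [Fx] or [Fy]. *)
Record C1 (F Fs Fx Fy : R -> R -> R -> R) : Prop := {
  C1_s : forall s x y, is_derive (fun s => F s x y) s (Fs s x y);
  C1_x : forall s x y, is_derive (fun x => F s x y) x (Fx s x y);
  C1_y : forall s x y, is_derive (fun y => F s x y) y (Fy s x y);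
  C1_cont : continuous3 F;
  C1_cont_s : continuous3 Fs;
  C1_cont_x : continuous3 Fx;
  C1_cont_y : continuous3 Fy
}.

Lemma C1_comp (F Fs Fx Fy : R -> R -> R -> R) (f g : R -> R) (s u f' g' : R) :
  C1 F Fs Fx Fy -> is_derive f u f' -> is_derive g u g' ->
  is_derive (fun u => F s (f u) (g u)) u
    (Fx s (f u) (g u) * f' + Fy s (f u) (g u) * g').
Proof.
intros [Ds Dx Dy CF CFs CFx CFy] Hf Hg.
apply (is_derive_comp2 (F s) (Fx s)); auto; continuity.
Qed.

Lemma C1_comp_diag (F Fs Fx Fy : R -> R -> R -> R) (f g : R -> R)
  (s f' g' : R) :
  C1 F Fs Fx Fy -> (forall s, continuous f s) -> (forall s, continuous g s) ->
  is_derive f s f' -> is_derive g s g' ->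
  is_derive (fun s => F s (f s) (g s)) s
    (Fs s (f s) (g s) + (Fx s (f s) (g s) * f' + Fy s (f s) (g s) * g')).
Proof.
intros HF Cf Cg Hf Hg.
(* The composite is read on the diagonal of [(a, b)], where [a] moves the parameter and [b] moves
   the point; the factors [1] are the derivatives of the two identity paths. *)
apply is_derive_value with (Fs s (f s) (g s) * 1
  + (Fx s (f s) (g s) * f' + Fy s (f s) (g s) * g') * 1); [|ring].
apply (is_derive_comp2 (fun a b => F a (f b) (g b))
  (fun a b => Fs a (f b) (g b)) _ (fun s => s) (fun s => s)).
- intros; apply (C1_s _ _ _ _ HF).
- apply (C1_comp _ _ _ _ _ _ _ _ _ _ HF Hf Hg).
- pose proof (C1_cont_s _ _ _ _ HF); continuity.
- exact (is_derive_id s).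
- exact (is_derive_id s).
Qed.

Lemma is_derive_Rplus (f g : R -> R) (x f' g' : R) :
  is_derive f x f' -> is_derive g x g' ->
  is_derive (fun x => f x + g x) x (f' + g').
Proof. exact (is_derive_plus f g x f' g'). Qed.

Lemma is_derive_Rminus (f g : R -> R) (x f' g' : R) :
  is_derive f x f' -> is_derive g x g' ->
  is_derive (fun x => f x - g x) x (f' - g').
Proof. exact (is_derive_minus f g x f' g'). Qed.

Lemma is_derive_Rmult (f g : R -> R) (x f' g' : R) :
  is_derive f x f' -> is_derive g x g' ->
  is_derive (fun x => f x * g x) x (f' * g x + f x * g').
Proof.
intros Hf Hg; exact (is_derive_mult f g x f' g' Hf Hg Rmult_comm).
Qed.

Definition C1_path (f f' : R -> R) : Prop :=
  (forall s, is_derive f s (f' s)) /\ (forall s, continuous f' s).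

Lemma C1_path_continuous (f f' : R -> R) :
  C1_path f f' -> forall s, continuous f s.
Proof.
intros [H _] s; exact (ex_derive_continuous f s (ex_intro _ _ (H s))).
Qed.

(** The two [C1] cases differ in whether the first argument of [F] moves with the variable of
    differentiation or stays fixed. *)
Ltac derivative :=
  repeat match goal with
  | |- is_derive (fun _ => ?c) _ _ => exact (is_derive_const c _)
  | |- is_derive (fun x => x) _ _ => exact (is_derive_id _)
  | |- is_derive (fun x => _ + _) _ _ => apply is_derive_Rplus
  | |- is_derive (fun x => _ - _) _ _ => apply is_derive_Rminus
  | |- is_derive (fun x => _ * _) _ _ => apply is_derive_Rmult
  | H : forall s, is_derive ?w s _ |- is_derive (fun x => ?w x) _ _ => apply H
  | H : forall s, is_derive ?w s _ |- is_derive ?w _ _ => apply H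
  | H : C1 ?F _ _ _ |- is_derive (fun x => ?F x (@?f x) (@?g x)) ?s _ =>
      eapply (C1_comp_diag F _ _ _ f g s _ _ H);
        [intros; continuity | intros; continuity | |]
  | H : C1 ?F _ _ _ |- is_derive (fun x => ?F ?s (@?f x) (@?g x)) ?a _ =>
      eapply (C1_comp F _ _ _ f g s a _ _ H)
  end.

(* The Reynolds transport formula on the parallelogram spanned by the moving
   vectors [(p s, q s)] and [(u s, w s)].  If [rho_s = div X] and
   [Y = X + rho * (velocity of the moving coordinates)], then the integrand
   satisfies [d/ds (cross * rho) = d/da cross(Y, w2) + d/db cross(w1, Y)]; the
   hypotheses on [Y] say that it descends to the torus. *)
Lemma is_derive_moving_torus_integral
  (rho rhos rhox rhoy X Xs Xx Xy Z Zs Zx Zy : R -> R -> R -> R)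
  (p p' q q' u u' w w' : R -> R) (s : R) :
  C1 rho rhos rhox rhoy -> C1 X Xs Xx Xy -> C1 Z Zs Zx Zy ->
  C1_path p p' -> C1_path q q' -> C1_path u u' -> C1_path w w' ->
  (forall x y, rhos s x y = Xx s x y + Zy s x y) ->
  let x := fun s a b => a * p s + b * u s in
  let y := fun s a b => a * q s + b * w s in
  let Y1 := fun a b => X s (x s a b) (y s a b)
    + rho s (x s a b) (y s a b) * (a * p' s + b * u' s) in
  let Y2 := fun a b => Z s (x s a b) (y s a b)
    + rho s (x s a b) (y s a b) * (a * q' s + b * w' s) in
  (forall b, Y1 1 b = Y1 0 b /\ Y2 1 b = Y2 0 b) ->
  (forall a, Y1 a 1 = Y1 a 0 /\ Y2 a 1 = Y2 a 0) ->
  is_derive (fun s => RInt (fun a => RInt (fun b =>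
    (p s * w s - q s * u s) * rho s (x s a b) (y s a b)) 0 1) 0 1) s 0.
Proof.
intros Hrho HX HZ Hp Hq Hu Hw Hdiv x y Y1 Y2 H1 H2.
pose proof (C1_path_continuous _ _ Hp) as Cp.
pose proof (C1_path_continuous _ _ Hq) as Cq.
pose proof (C1_path_continuous _ _ Hu) as Cu.
pose proof (C1_path_continuous _ _ Hw) as Cw.
destruct Hp as [Dp Cp'], Hq as [Dq Cq'], Hu as [Du Cu'], Hw as [Dw Cw'].
pose proof Hrho as [_ _ _ K1 K2 K3 K4].
pose proof HX as [_ _ _ K5 K6 K7 K8].
pose proof HZ as [_ _ _ K9 K10 K11 K12].
(* In order: the [s]-derivative of the integrand, [cross (Y, w2)], its [a]-derivative,
   [cross (w1, Y)] and its [b]-derivative, where [w1 = (p s, q s)] and [w2 = (u s, w s)]. *)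
apply (is_derive_double_integral_zero _
  (fun s a b => (p' s * w s + p s * w' s - (q' s * u s + q s * u' s))
      * rho s (x s a b) (y s a b)
    + (p s * w s - q s * u s) * (rhos s (x s a b) (y s a b)
      + (rhox s (x s a b) (y s a b) * (a * p' s + b * u' s)
        + rhoy s (x s a b) (y s a b) * (a * q' s + b * w' s))))
  (fun a b => Y1 a b * w s - Y2 a b * u s)
  (fun a b =>
    (Xx s (x s a b) (y s a b) * p s + Xy s (x s a b) (y s a b) * q s
     + ((rhox s (x s a b) (y s a b) * p s + rhoy s (x s a b) (y s a b) * q s)
        * (a * p' s + b * u' s) + rho s (x s a b) (y s a b) * p' s)) * w s
    - (Zx s (x s a b) (y s a b) * p s + Zy s (x s a b) (y s a b) * q s
     + ((rhox s (x s a b) (y s a b) * p s + rhoy s (x s a b) (y s a b) * q s)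
        * (a * q' s + b * w' s) + rho s (x s a b) (y s a b) * q' s)) * u s)
  (fun a b => p s * Y2 a b - q s * Y1 a b)
  (fun a b =>
    p s * (Zx s (x s a b) (y s a b) * u s + Zy s (x s a b) (y s a b) * w s
     + ((rhox s (x s a b) (y s a b) * u s + rhoy s (x s a b) (y s a b) * w s)
        * (a * q' s + b * w' s) + rho s (x s a b) (y s a b) * w' s))
    - q s * (Xx s (x s a b) (y s a b) * u s + Xy s (x s a b) (y s a b) * w s
     + ((rhox s (x s a b) (y s a b) * u s + rhoy s (x s a b) (y s a b) * w s)
        * (a * p' s + b * u' s) + rho s (x s a b) (y s a b) * u' s)))).
- intros t a b; unfold x, y; continuity.
- intros t a b; unfold x, y; continuity.
- intros t a b; unfold x, y; eapply is_derive_value; [derivative|].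
  unfold zero; simpl; ring_R.
- intros a b; unfold Y1, Y2, x, y; eapply is_derive_value; [derivative|].
  unfold zero, one; simpl; ring_R.
- intros a b; unfold Y1, Y2, x, y; eapply is_derive_value; [derivative|].
  unfold zero, one; simpl; ring_R.
- intros a b; unfold Y1, Y2, x, y; continuity.
- intros a b; unfold x, y; continuity.
- intros a b; unfold x, y; continuity.
- intros b; destruct (H1 b) as [-> ->]; reflexivity.
- intros a; destruct (H2 a) as [-> ->]; reflexivity.
(* The mixed terms [Xy] and [Zx] cancel; what remains of the derivatives of [X] and [Z] is
   [p s * w s - q s * u s] times the divergence. *)
- intros a b; rewrite Hdiv; ring.
Qed.

(** * Smooth functions of the times *)

(** Appending [n] to the list makes [partial n] the innermost derivative. *)
Lemma smooth_partial (n : nat) (g : (nat -> R) -> R) :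
  smooth g -> smooth (partial n g).
Proof.
intros Hg l; specialize (Hg (l ++ n :: nil)%list).
rewrite fold_right_app in Hg; exact Hg.
Qed.

Definition point (t : nat -> R) (n : nat) (s x y : R) : nat -> R :=
  upd (upd (upd t 0 x) 1 y) n s.

Definition slice (t : nat -> R) (n : nat) (g : (nat -> R) -> R) (s x y : R) : R :=
  g (point t n s x y).

Lemma point_supp (t : nat -> R) (n N : nat) (s x y : R) :
  (forall m, (N <= m)%nat -> t m = 0) ->
  forall m, (N + n + 2 <= m)%nat -> point t n s x y m = 0.
Proof.
intros Ht m Hm; unfold point, upd.
destruct (Nat.eqb_spec m n), (Nat.eqb_spec m 1), (Nat.eqb_spec m 0);
  try lia; apply Ht; lia.
Qed.

Lemma continuous3_slice (t : nat -> R) (n : nat) (g : (nat -> R) -> R) :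
  fin_supp t -> continuous_fin g -> continuous3 (slice t n g).
Proof.
intros [N HN] Hg s x y P [eps HP].
destruct (Hg _ _ (point_supp t n N s x y HN) _ (cond_pos eps)) as [d [Hd H]].
exists (mkposreal d Hd); intros [s' [x' y']] [H1 [H2 H3]]; apply HP.
apply H; [apply point_supp; exact HN|].
intros m _; unfold point, upd; simpl.
destruct (Nat.eqb m n); [exact H1|].
destruct (Nat.eqb m 1); [exact H3|].
destruct (Nat.eqb m 0); [exact H2|].
rewrite Rminus_eq_0, Rabs_R0; exact Hd.
Qed.

(** The bound [2 <= n] keeps the moving time apart from the plane indices [0] and [1], so the three
    updates in [point] are independent and each partial derivative of [g] is one of the slice. *)
Lemma smooth_slice_C1 (t : nat -> R) (n : nat) (g : (nat -> R) -> R) :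
  (2 <= n)%nat -> fin_supp t -> smooth g ->
  C1 (slice t n g) (slice t n (partial n g)) (slice t n (partial 0 g))
    (slice t n (partial 1 g)).
Proof.
intros Hn Ht Hg.
assert (Hs : forall s x y, fin_supp (point t n s x y)).
{ destruct Ht as [N HN]; intros s x y.
  exists (N + n + 2)%nat; apply point_supp; exact HN. }
assert (D : forall m p, fin_supp p ->
  is_derive (fun a => g (upd p m a)) (p m) (partial m g p)).
(* The empty list of derivatives gives the differentiability of [g] itself. *)
{ intros m p Hp; apply Derive_correct, (proj2 (Hg nil) m p Hp). }
assert (C : forall h, smooth h -> continuous3 (slice t n h))
  by (intros h Hh; apply continuous3_slice; [exact Ht|exact (proj1 (Hh nil))]).
assert (E : forall s x y a,
  upd (point t n s x y) n a = point t n a x y /\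
  upd (point t n s x y) 0 a = point t n s a y /\
  upd (point t n s x y) 1 a = point t n s x a).
{ intros s x y a; repeat split; apply functional_extensionality; intros m;
    unfold point, upd;
    destruct (Nat.eqb_spec m n), (Nat.eqb_spec m 1), (Nat.eqb_spec m 0);
    subst; try lia; reflexivity. }
assert (V : forall s x y, point t n s x y n = s /\ point t n s x y 0 = x /\
  point t n s x y 1 = y).
{ intros s x y; unfold point, upd; repeat split.
  - rewrite Nat.eqb_refl; reflexivity.
  - destruct (Nat.eqb_spec 0 n); [lia|reflexivity].
  - destruct (Nat.eqb_spec 1 n); [lia|reflexivity]. }
split; try (apply C; repeat apply smooth_partial; exact Hg); intros s x y;
  destruct (V s x y) as [V1 [V2 V3]].
- generalize (D n _ (Hs s x y)); rewrite V1; apply is_derive_ext.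
  intros a; destruct (E s x y a) as [-> _]; reflexivity.
- generalize (D 0%nat _ (Hs s x y)); rewrite V2; apply is_derive_ext.
  intros a; destruct (E s x y a) as [_ [-> _]]; reflexivity.
- generalize (D 1%nat _ (Hs s x y)); rewrite V3; apply is_derive_ext.
  intros a; destruct (E s x y a) as [_ [_ ->]]; reflexivity.
Qed.

(** * Symmetry of mixed derivatives *)

Lemma Schwarz_continuous (F Fu Fv Fuv Fvu : R -> R -> R) (u v : R) :
  (forall u v, is_derive (fun u => F u v) u (Fu u v)) ->
  (forall u v, is_derive (fun v => F u v) v (Fv u v)) ->
  (forall u v, is_derive (fun v => Fu u v) v (Fuv u v)) ->
  (forall u v, is_derive (fun u => Fv u v) u (Fvu u v)) ->
  continuous (fun q : R * R => Fuv (fst q) (snd q)) (u, v) ->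
  continuous (fun q : R * R => Fvu (fst q) (snd q)) (u, v) ->
  Fuv u v = Fvu u v.
Proof.
intros Hu Hv Huv Hvu Cuv Cvu.
(* The given second derivatives are recovered as nested [Derive] terms, the form in which [Schwarz]
   states the symmetry. *)
assert (Du : forall u v, is_derive (fun z => Derive (fun t => F z t) v) u (Fvu u v)).
{ intros u' v'; generalize (Hvu u' v'); apply is_derive_ext.
  intros z; symmetry; apply is_derive_unique, Hv. }
assert (Dv : forall u v, is_derive (fun z => Derive (fun t => F t z) u) v (Fuv u v)).
{ intros u' v'; generalize (Huv u' v'); apply is_derive_ext.
  intros z; symmetry; apply is_derive_unique, Hu. }
rewrite <- (is_derive_unique _ _ _ (Dv u v)), <- (is_derive_unique _ _ _ (Du u v)).
symmetry; apply Schwarz.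
- exists (mkposreal 1 Rlt_0_1); intros a b _ _; repeat split; eexists; auto.
- apply continuity_2d_pt_ext with Fvu;
    [intros; symmetry; apply is_derive_unique, Du|].
  apply continuity_2d_pt_filterlim, Cvu.
- apply continuity_2d_pt_ext with Fuv;
    [intros; symmetry; apply is_derive_unique, Dv|].
  apply continuity_2d_pt_filterlim, Cuv.
Qed.

(** Freezing [y] leaves two variables. The identity turns the variation of [Fx] into the
    [x]-derivative of the variation [Fs]. *)
Lemma C1_Schwarz_sx (F Fs Fx Fy Fss Fsx Fsy Fxs Fxx Fxy : R -> R -> R -> R) :
  C1 F Fs Fx Fy -> C1 Fs Fss Fsx Fsy -> C1 Fx Fxs Fxx Fxy ->
  forall s x y, Fxs s x y = Fsx s x y.
Proof.
intros H Hs Hx s x y.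
pose proof (C1_cont_x _ _ _ _ Hs); pose proof (C1_cont_s _ _ _ _ Hx).
symmetry; apply (Schwarz_continuous (fun s x => F s x y) (fun s x => Fs s x y)
  (fun s x => Fx s x y) (fun s x => Fsx s x y) (fun s x => Fxs s x y));
  [| | | |continuity|continuity]; intros.
- apply (C1_s _ _ _ _ H).
- apply (C1_x _ _ _ _ H).
- apply (C1_x _ _ _ _ Hs).
- apply (C1_s _ _ _ _ Hx).
Qed.

Lemma C1_Schwarz_sy (F Fs Fx Fy Fss Fsx Fsy Fys Fyx Fyy : R -> R -> R -> R) :
  C1 F Fs Fx Fy -> C1 Fs Fss Fsx Fsy -> C1 Fy Fys Fyx Fyy ->
  forall s x y, Fys s x y = Fsy s x y.
Proof.
intros H Hs Hy s x y.
pose proof (C1_cont_y _ _ _ _ Hs); pose proof (C1_cont_s _ _ _ _ Hy).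
symmetry; apply (Schwarz_continuous (fun s y => F s x y) (fun s y => Fs s x y)
  (fun s y => Fy s x y) (fun s y => Fsy s x y) (fun s y => Fys s x y));
  [| | | |continuity|continuity]; intros.
- apply (C1_s _ _ _ _ H).
- apply (C1_y _ _ _ _ H).
- apply (C1_y _ _ _ _ Hs).
- apply (C1_s _ _ _ _ Hy).
Qed.

(** * Sums and products of [C1] families *)

Lemma C1_plus (F Fs Fx Fy G Gs Gx Gy : R -> R -> R -> R) :
  C1 F Fs Fx Fy -> C1 G Gs Gx Gy ->
  C1 (fun s x y => F s x y + G s x y) (fun s x y => Fs s x y + Gs s x y)
    (fun s x y => Fx s x y + Gx s x y) (fun s x y => Fy s x y + Gy s x y).
Proof.
intros [F1 F2 F3 F4 F5 F6 F7] [G1 G2 G3 G4 G5 G6 G7].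
split; intros s x y; try (apply is_derive_Rplus; auto); continuity.
Qed.

Lemma C1_mult (F Fs Fx Fy G Gs Gx Gy : R -> R -> R -> R) :
  C1 F Fs Fx Fy -> C1 G Gs Gx Gy ->
  C1 (fun s x y => F s x y * G s x y)
    (fun s x y => Fs s x y * G s x y + F s x y * Gs s x y)
    (fun s x y => Fx s x y * G s x y + F s x y * Gx s x y)
    (fun s x y => Fy s x y * G s x y + F s x y * Gy s x y).
Proof.
intros [F1 F2 F3 F4 F5 F6 F7] [G1 G2 G3 G4 G5 G6 G7].
split; intros s x y; 
  try (eapply is_derive_value; [apply is_derive_Rmult; auto|reflexivity]);
  continuity.
Qed.

Lemma C1_scal (k : R) (F Fs Fx Fy : R -> R -> R -> R) :
  C1 F Fs Fx Fy ->
  C1 (fun s x y => k * F s x y) (fun s x y => k * Fs s x y)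
    (fun s x y => k * Fx s x y) (fun s x y => k * Fy s x y).
Proof.
intros [F1 F2 F3 F4 F5 F6 F7].
split; intros s x y; try (apply is_derive_scal; auto); continuity.
Qed.

(** * The energy of a moving torus *)

(* The six real coordinates of [C^3]: [(k, true)] is the real and [(k, false)]
   the imaginary part of the [k]-th complex coordinate. *)
Definition ridx : Set := idx * bool.

Definition rsum (h : ridx -> R) : R :=
  h (k1, true) + h (k1, false) + (h (k2, true) + h (k2, false))
  + (h (k3, true) + h (k3, false)).

Definition cvec (h : ridx -> R) : vec := fun k => (h (k, true), h (k, false)).

Lemma rsum_ext (f g : ridx -> R) : (forall c, f c = g c) -> rsum f = rsum g.
Proof. intros H; unfold rsum; rewrite !H; reflexivity. Qed.

Lemma Re_herm_cvec (g h : ridx -> R) :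
  Re (herm (cvec g) (cvec h)) = rsum (fun c => g c * h c).
Proof. unfold herm, sum3, cvec, rsum; simpl; ring. Qed.

Lemma C1_rsum (F Fs Fx Fy : ridx -> R -> R -> R -> R) :
  (forall c, C1 (F c) (Fs c) (Fx c) (Fy c)) ->
  C1 (fun s x y => rsum (fun c => F c s x y))
    (fun s x y => rsum (fun c => Fs c s x y))
    (fun s x y => rsum (fun c => Fx c s x y))
    (fun s x y => rsum (fun c => Fy c s x y)).
Proof. intros H; unfold rsum; repeat apply C1_plus; apply H. Qed.

(** In contrast to [FS_hopf], [u] may have a component along [r]: each of the two mixed products in
    the trace contains [herm w r] or its conjugate. The variation of a lift is such a vector [u]. *)
Lemma FS_dhopf (r u w : vec) :
  herm r r = RtoC 1 -> herm w r = RtoC 0 ->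
  FS (dhopf r u) (dhopf r w) = Re (herm u w).
Proof.
intros Hr Hw.
assert (Hw' : herm r w = RtoC 0).
{ apply (f_equal Cconj) in Hw; revert Hw; unfold herm, sum3.
  rewrite !Cplus_conj, !Cmult_conj, !Cconj_conj.
  intros H; rewrite (Cmult_comm (r k1)), (Cmult_comm (r k2)),
    (Cmult_comm (r k3)), H.
  apply injective_projections; simpl; ring. }
assert (E : trace (mmul (dhopf r u) (dhopf r w))
  = (herm u w * herm r r + herm w u * herm r r
     + herm w r * herm u r + herm r u * herm r w)%C)
  by (unfold trace, mmul, dhopf, herm, sum3; ring).
unfold FS; rewrite E, Hr, Hw, Hw'; unfold herm, sum3; simpl; field.
Qed.

Lemma FS_ext (X X' Y Y' : mat) :
  (forall i j, X i j = X' i j) -> (forall i j, Y i j = Y' i j) ->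
  FS X Y = FS X' Y'.
Proof. intros HX HY; unfold FS, trace, mmul, sum3; rewrite !HX, !HY; reflexivity. Qed.

Lemma is_derive_hopf (Q : R -> ridx -> R) (u : ridx -> R) (s : R) (i j : idx) :
  (forall c, is_derive (fun s => Q s c) s (u c)) ->
  is_derive (fun s => Re (hopf (cvec (Q s)) i j)) s
    (Re (dhopf (cvec (Q s)) (cvec u) i j)) /\
  is_derive (fun s => Im (hopf (cvec (Q s)) i j)) s
    (Im (dhopf (cvec (Q s)) (cvec u) i j)).
Proof.
intros H; unfold hopf, dhopf, cvec; simpl; split.
- apply (is_derive_ext (fun s => Q s (i, true) * Q s (j, true)
    + Q s (i, false) * Q s (j, false))); [intros; simpl; ring_R|].
  eapply is_derive_value;
    [apply is_derive_Rplus; apply is_derive_Rmult; apply H|simpl; ring].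
- apply (is_derive_ext (fun s => Q s (i, false) * Q s (j, true)
    - Q s (i, true) * Q s (j, false))); [intros; simpl; ring_R|].
  eapply is_derive_value;
    [apply is_derive_Rminus; apply is_derive_Rmult; apply H|simpl; ring].
Qed.

(** Each side is the derivative of the projected path in [CP2], so it does not depend on the phase
    of the lift. *)
Lemma dhopf_unique (Q1 Q2 : R -> ridx -> R) (u1 u2 : ridx -> R) (s : R) :
  (forall s i j, hopf (cvec (Q1 s)) i j = hopf (cvec (Q2 s)) i j) ->
  (forall c, is_derive (fun s => Q1 s c) s (u1 c)) ->
  (forall c, is_derive (fun s => Q2 s c) s (u2 c)) ->
  forall i j, dhopf (cvec (Q1 s)) (cvec u1) i j
    = dhopf (cvec (Q2 s)) (cvec u2) i j.
Proof.
intros HQ H1 H2 i j.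
destruct (is_derive_hopf Q1 u1 s i j H1) as [R1 I1].
destruct (is_derive_hopf Q2 u2 s i j H2) as [R2 I2].
apply is_derive_unique in R1, R2, I1, I2.
apply injective_projections.
- unfold Re in R1, R2; rewrite <- R1, <- R2.
  apply Derive_ext; intros s'; rewrite HQ; reflexivity.
- unfold Im in I1, I2; rewrite <- I1, <- I2.
  apply Derive_ext; intros s'; rewrite HQ; reflexivity.
Qed.

Definition at3 (F : ridx -> R -> R -> R -> R) (s x y : R) : ridx -> R :=
  fun c => F c s x y.

Definition rdot (F G : ridx -> R -> R -> R -> R) (s x y : R) : R :=
  rsum (fun c => F c s x y * G c s x y).

(** The Dirichlet density. It agrees with the area density in conformal coordinates and, having no
    square root, is polynomial in the first derivatives. *)
Definition energy (Fx Fy : ridx -> R -> R -> R -> R) (s x y : R) : R :=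
  / 2 * (rdot Fx Fx s x y + rdot Fy Fy s x y).

Lemma C1_rdot (F Fs Fx Fy G Gs Gx Gy : ridx -> R -> R -> R -> R) :
  (forall c, C1 (F c) (Fs c) (Fx c) (Fy c)) ->
  (forall c, C1 (G c) (Gs c) (Gx c) (Gy c)) ->
  C1 (rdot F G)
    (fun s x y => rsum (fun c => Fs c s x y * G c s x y + F c s x y * Gs c s x y))
    (fun s x y => rsum (fun c => Fx c s x y * G c s x y + F c s x y * Gx c s x y))
    (fun s x y => rsum (fun c => Fy c s x y * G c s x y + F c s x y * Gy c s x y)).
Proof.
intros HF HG.
apply (C1_rsum (fun c s x y => F c s x y * G c s x y)); intros c.
exact (C1_mult _ _ _ _ _ _ _ _ (HF c) (HG c)).
Qed.

Lemma C1_energy (Fx Fxs Fxx Fxy Fy Fys Fyx Fyy : ridx -> R -> R -> R -> R) :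
  (forall c, C1 (Fx c) (Fxs c) (Fxx c) (Fxy c)) ->
  (forall c, C1 (Fy c) (Fys c) (Fyx c) (Fyy c)) ->
  C1 (energy Fx Fy)
    (fun s x y => / 2 *
      (rsum (fun c => Fxs c s x y * Fx c s x y + Fx c s x y * Fxs c s x y)
       + rsum (fun c => Fys c s x y * Fy c s x y + Fy c s x y * Fys c s x y)))
    (fun s x y => / 2 *
      (rsum (fun c => Fxx c s x y * Fx c s x y + Fx c s x y * Fxx c s x y)
       + rsum (fun c => Fyx c s x y * Fy c s x y + Fy c s x y * Fyx c s x y)))
    (fun s x y => / 2 *
      (rsum (fun c => Fxy c s x y * Fx c s x y + Fx c s x y * Fxy c s x y)
       + rsum (fun c => Fyy c s x y * Fy c s x y + Fy c s x y * Fyy c s x y))).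
Proof.
intros Hx Hy.
exact (C1_scal (/ 2) _ _ _ _ (C1_plus _ _ _ _ _ _ _ _
  (C1_rdot _ _ _ _ _ _ _ _ Hx Hx) (C1_rdot _ _ _ _ _ _ _ _ Hy Hy))).
Qed.

(** This is the first variation formula. Once mixed derivatives are exchanged, the two sides differ
    by the product of [Fs] with the Laplacian of [F]. That Laplacian is a multiple of [F], and [Fs]
    is orthogonal to [F] on the sphere. *)
Lemma energy_divergence
  (F Fs Fx Fy Fss Fsx Fsy Fxs Fxx Fxy Fys Fyx Fyy : ridx -> R -> R -> R -> R)
  (V : R -> R -> R -> R) :
  (forall c, C1 (F c) (Fs c) (Fx c) (Fy c)) ->
  (forall c, C1 (Fs c) (Fss c) (Fsx c) (Fsy c)) ->
  (forall c, C1 (Fx c) (Fxs c) (Fxx c) (Fxy c)) ->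
  (forall c, C1 (Fy c) (Fys c) (Fyx c) (Fyy c)) ->
  (forall s x y, rdot F F s x y = 1) ->
  (forall c s x y, Fxx c s x y + Fyy c s x y + V s x y * F c s x y = 0) ->
  forall s x y,
    / 2 *
    (rsum (fun c => Fxs c s x y * Fx c s x y + Fx c s x y * Fxs c s x y)
     + rsum (fun c => Fys c s x y * Fy c s x y + Fy c s x y * Fys c s x y))
    = rsum (fun c => Fsx c s x y * Fx c s x y + Fs c s x y * Fxx c s x y)
      + rsum (fun c => Fsy c s x y * Fy c s x y + Fs c s x y * Fyy c s x y).
Proof.
intros H Hs Hx Hy HF HV s x y.
(* The constant norm of [F] is differentiated in [s]. *)
assert (O : rsum (fun c => Fs c s x y * F c s x y + F c s x y * Fs c s x y) = 0).
{ rewrite <- (is_derive_unique _ _ _ (C1_s _ _ _ _ (C1_rdot _ _ _ _ _ _ _ _ H H) s x y)).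
  rewrite (Derive_ext _ (fun _ => 1)) by (intros; apply HF); apply Derive_const. }
rewrite (rsum_ext _ (fun c => Fsx c s x y * Fx c s x y + Fx c s x y * Fsx c s x y))
  by (intros c; rewrite (C1_Schwarz_sx _ _ _ _ _ _ _ _ _ _ (H c) (Hs c) (Hx c));
      reflexivity).
rewrite (rsum_ext (fun c => Fys c s x y * _ + _)
  (fun c => Fsy c s x y * Fy c s x y + Fy c s x y * Fsy c s x y))
  by (intros c; rewrite (C1_Schwarz_sy _ _ _ _ _ _ _ _ _ _ (H c) (Hs c) (Hy c));
      reflexivity).
(* Eliminating [Fxx] by the equation makes the [Fyy] terms of the two sums cancel. *)
rewrite (rsum_ext (fun c => Fsx c s x y * Fx c s x y + Fs c s x y * _)
  (fun c => Fsx c s x y * Fx c s x y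
    + Fs c s x y * (- Fyy c s x y - V s x y * F c s x y)))
  by (intros c; f_equal; f_equal; generalize (HV c s x y); lra).
apply Rminus_diag_uniq.
transitivity (V s x y / 2 *
  rsum (fun c => Fs c s x y * F c s x y + F c s x y * Fs c s x y));
  [unfold rsum; field|rewrite O; ring].
Qed.

(* The field is [X = (rdot Fs Fx, rdot Fs Fy)].  In coordinates moving with the
   lattice, [X + energy * velocity] consists of the inner products of the
   variation of the doubly periodic map [hopf r] with its two derivatives; this
   is why it is periodic although [X] is not. *)
Lemma is_derive_moving_torus_energy
  (F Fs Fx Fy Fss Fsx Fsy Fxs Fxx Fxy Fys Fyx Fyy : ridx -> R -> R -> R -> R)
  (V : R -> R -> R -> R) (p p' q q' u u' w w' : R -> R) :
  (forall c, C1 (F c) (Fs c) (Fx c) (Fy c)) ->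
  (forall c, C1 (Fs c) (Fss c) (Fsx c) (Fsy c)) ->
  (forall c, C1 (Fx c) (Fxs c) (Fxx c) (Fxy c)) ->
  (forall c, C1 (Fy c) (Fys c) (Fyx c) (Fyy c)) ->
  C1_path p p' -> C1_path q q' -> C1_path u u' -> C1_path w w' ->
  (forall c s x y, Fxx c s x y + Fyy c s x y + V s x y * F c s x y = 0) ->
  (forall s x y, herm (cvec (at3 F s x y)) (cvec (at3 F s x y)) = RtoC 1) ->
  (forall s x y, herm (cvec (at3 Fx s x y)) (cvec (at3 F s x y)) = RtoC 0) ->
  (forall s x y, herm (cvec (at3 Fy s x y)) (cvec (at3 F s x y)) = RtoC 0) ->
  (forall s x y, rdot Fx Fy s x y = 0) ->
  (forall s x y, rdot Fx Fx s x y = rdot Fy Fy s x y) ->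
  (forall s x y i j,
    hopf (cvec (at3 F s (x + p s) (y + q s))) i j = hopf (cvec (at3 F s x y)) i j /\
    hopf (cvec (at3 F s (x + u s) (y + w s))) i j = hopf (cvec (at3 F s x y)) i j) ->
  forall s,
  is_derive (fun s => RInt (fun a => RInt (fun b => (p s * w s - q s * u s) *
    energy Fx Fy s (a * p s + b * u s) (a * q s + b * w s)) 0 1) 0 1) s 0.
Proof.
intros H Hs Hx Hy Hp Hq Hu Hw HV H1 HxF HyF Hxy Hxx Hper s.
(* An arbitrary moving period [(dx, dy)] is used so that one argument serves both pairs of opposite
   sides. The relations [Ex] and [Ey] are required for all [s] because they are used inside an
   [s]-derivative. *)
assert (Y : forall dx dy,
  (forall s x y i j, hopf (cvec (at3 F s (x + dx s) (y + dy s))) i j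
    = hopf (cvec (at3 F s x y)) i j) ->
  forall a b a' b',
  (forall s, a * p s + b * u s = a' * p s + b' * u s + dx s) ->
  (forall s, a * q s + b * w s = a' * q s + b' * w s + dy s) ->
  let Y1 a b := rdot Fs Fx s (a * p s + b * u s) (a * q s + b * w s)
    + energy Fx Fy s (a * p s + b * u s) (a * q s + b * w s)
      * (a * p' s + b * u' s) in
  let Y2 a b := rdot Fs Fy s (a * p s + b * u s) (a * q s + b * w s)
    + energy Fx Fy s (a * p s + b * u s) (a * q s + b * w s)
      * (a * q' s + b * w' s) in
  Y1 a b = Y1 a' b' /\ Y2 a b = Y2 a' b').
{ intros dx dy Hd a b a' b' Ex Ey Y1 Y2.
  pose (r := fun a b s => at3 F s (a * p s + b * u s) (a * q s + b * w s)).
  (* The total [s]-derivative of [r] at a fixed point of the unit square, including the velocity of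
     the lattice. *)
  pose (r_s := fun a b c => let x := a * p s + b * u s in
    let y := a * q s + b * w s in Fs c s x y
      + (Fx c s x y * (a * p' s + b * u' s) + Fy c s x y * (a * q' s + b * w' s))).
  assert (D : forall a b c, is_derive (fun s => r a b s c) s (r_s a b c)).
  { intros a0 b0 c; unfold r, r_s, at3.
    pose proof (C1_path_continuous _ _ Hp); pose proof (C1_path_continuous _ _ Hq).
    pose proof (C1_path_continuous _ _ Hu); pose proof (C1_path_continuous _ _ Hw).
    destruct Hp as [Dp _], Hq as [Dq _], Hu as [Du _], Hw as [Dw _].
    specialize (H c).
    eapply is_derive_value; [derivative|unfold zero; simpl; ring]. }
  (* By conformality the energy equals [rdot Fx Fx], and [rdot Fx Fy] vanishes; hence [Y1] is the
     real inner product of [r_s] with the horizontal vector [Fx]. *)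
  assert (E1 : forall a b, Y1 a b = FS (dhopf (cvec (r a b s)) (cvec (r_s a b)))
    (dhopf (cvec (r a b s)) (cvec (at3 Fx s (a * p s + b * u s) (a * q s + b * w s))))).
  { intros a0 b0; rewrite FS_dhopf by (apply H1 || apply HxF).
    rewrite Re_herm_cvec; unfold Y1, r_s, at3, energy.
    set (x := a0 * p s + b0 * u s); set (y := a0 * q s + b0 * w s).
    generalize (Hxx s x y) (Hxy s x y); intros E1 E2; rewrite <- E1.
    transitivity (rdot Fs Fx s x y + rdot Fx Fx s x y * (a0 * p' s + b0 * u' s)
      + rdot Fx Fy s x y * (a0 * q' s + b0 * w' s)); [rewrite E2; field|].
    unfold rdot, rsum; ring. }
  assert (E2 : forall a b, Y2 a b = FS (dhopf (cvec (r a b s)) (cvec (r_s a b)))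
    (dhopf (cvec (r a b s)) (cvec (at3 Fy s (a * p s + b * u s) (a * q s + b * w s))))).
  { intros a0 b0; rewrite FS_dhopf by (apply H1 || apply HyF).
    rewrite Re_herm_cvec; unfold Y2, r_s, at3, energy.
    set (x := a0 * p s + b0 * u s); set (y := a0 * q s + b0 * w s).
    generalize (Hxx s x y) (Hxy s x y); intros E2 E3; rewrite E2.
    transitivity (rdot Fs Fy s x y + rdot Fx Fy s x y * (a0 * p' s + b0 * u' s)
      + rdot Fy Fy s x y * (a0 * q' s + b0 * w' s)); [rewrite E3; field|].
    unfold rdot, rsum; ring. }
  rewrite !E1, !E2.
  (* The two paths have the same projection to [CP2] for every [s], hence the same projected
     velocity. *)
  assert (Es : forall i j, dhopf (cvec (r a b s)) (cvec (r_s a b)) i j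
    = dhopf (cvec (r a' b' s)) (cvec (r_s a' b')) i j).
  { apply (dhopf_unique (r a b) (r a' b')); auto.
    intros t i j; unfold r; rewrite Ex, Ey; apply Hd. }
  split; apply FS_ext; auto; unfold r; rewrite Ex, Ey.
  - set (x := a' * p s + b' * u s); set (y := a' * q s + b' * w s).
    (* Now [s] is frozen and periodicity is differentiated along the plane. *)
    apply (dhopf_unique (fun z => at3 F s (z + dx s) (y + dy s))
      (fun z => at3 F s z y)); [auto| |]; intros c; unfold at3.
    + pose proof (H c); eapply is_derive_value; [derivative|].
      unfold zero, one; simpl; ring.
    + apply (H c).
  - set (x := a' * p s + b' * u s); set (y := a' * q s + b' * w s).
    apply (dhopf_unique (fun z => at3 F s (x + dx s) (z + dy s))
      (fun z => at3 F s x z)); [auto| |]; intros c; unfold at3.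
    + pose proof (H c); eapply is_derive_value; [derivative|].
      unfold zero, one; simpl; ring.
    + apply (H c). }
refine (is_derive_moving_torus_integral (energy Fx Fy) _ _ _
  (rdot Fs Fx) _ _ _ (rdot Fs Fy) _ _ _ p p' q q' u u' w w' s
  (C1_energy _ _ _ _ _ _ _ _ Hx Hy)
  (C1_rdot _ _ _ _ _ _ _ _ Hs Hx) (C1_rdot _ _ _ _ _ _ _ _ Hs Hy)
  Hp Hq Hu Hw _ _ _).
- apply (energy_divergence F Fs Fx Fy Fss Fsx Fsy Fxs Fxx Fxy Fys Fyx Fyy V); auto.
  intros t x y; generalize (f_equal Re (H1 t x y)); rewrite Re_herm_cvec; auto.
- intros b; apply (Y p q); [intros; apply Hper| |]; intros; ring.
- intros a; apply (Y u w); [intros; apply Hper| |]; intros; ring.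
Qed.

(** The two tangent vectors are orthogonal and of equal length, so the determinant is the square of
    the energy. *)
Lemma sqrt_gdet_hopf (F Fs Fx Fy : ridx -> R -> R -> R -> R) (s x y : R) :
  (forall c, C1 (F c) (Fs c) (Fx c) (Fy c)) ->
  herm (cvec (at3 F s x y)) (cvec (at3 F s x y)) = RtoC 1 ->
  herm (cvec (at3 Fx s x y)) (cvec (at3 F s x y)) = RtoC 0 ->
  herm (cvec (at3 Fy s x y)) (cvec (at3 F s x y)) = RtoC 0 ->
  rdot Fx Fy s x y = 0 -> rdot Fx Fx s x y = rdot Fy Fy s x y ->
  0 <= energy Fx Fy s x y /\
  sqrt (gdet (fun x y => hopf (cvec (at3 F s x y))) x y) = energy Fx Fy s x y.
Proof.
intros H H1 HxF HyF Hxy Hxx.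
set (f := fun x y => hopf (cvec (at3 F s x y))).
assert (Ex : forall i j, mDx f x y i j
  = dhopf (cvec (at3 F s x y)) (cvec (at3 Fx s x y)) i j).
{ intros i j; unfold mDx, Dx, DeriveC, f.
  destruct (is_derive_hopf (fun a => at3 F s a y) (at3 Fx s x y) x i j) as [R I];
    [intros c; apply (H c)|].
  apply injective_projections; apply is_derive_unique; assumption. }
assert (Ey : forall i j, mDy f x y i j
  = dhopf (cvec (at3 F s x y)) (cvec (at3 Fy s x y)) i j).
{ intros i j; unfold mDy, Dy, DeriveC, f.
  destruct (is_derive_hopf (fun b => at3 F s x b) (at3 Fy s x y) y i j) as [R I];
    [intros c; apply (H c)|].
  apply injective_projections; apply is_derive_unique; assumption. }
assert (E : gdet f x y = energy Fx Fy s x y * energy Fx Fy s x y).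
{ unfold gdet, g11, g12, g22.
  rewrite (FS_ext _ _ _ _ Ex Ex), (FS_ext _ _ _ _ Ex Ey), (FS_ext _ _ _ _ Ey Ey).
  rewrite !FS_dhopf, !Re_herm_cvec by assumption.
  change (rdot Fx Fx s x y * rdot Fy Fy s x y - rdot Fx Fy s x y * rdot Fx Fy s x y
    = energy Fx Fy s x y * energy Fx Fy s x y).
  unfold energy; rewrite Hxy, Hxx; field. }
assert (P : 0 <= energy Fx Fy s x y).
{ unfold energy, rdot, rsum.
  repeat match goal with
  | |- context [?a * ?a] => generalize (Rle_0_sqr a); unfold Rsqr;
      generalize (a * a); intros ? ?
  end; lra. }
split; [exact P|]; rewrite E; apply sqrt_square, P.
Qed.

(** * Area along the deformation *)

Lemma slice_times (t : nat -> R) (n : nat) (G : (nat -> R) -> R -> R -> R) :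
  times t -> (2 <= n)%nat ->
  slice t n (fun p => G (times_of p) (p 0%nat) (p 1%nat))
  = (fun s x y => G (upd t n s) x y).
Proof.
intros [T0 [T1 _]] Hn.
apply functional_extensionality; intros s; apply functional_extensionality;
  intros x; apply functional_extensionality; intros y.
unfold slice; f_equal.
- f_equal; apply functional_extensionality; intros m.
  unfold times_of, point, upd.
  destruct (Nat.ltb_spec m 2), (Nat.eqb_spec m n); try lia; try reflexivity.
  (* At the indices [0] and [1], [times_of] gives zero while [upd t n s] keeps the values of [t],
     which vanish by [times t]. *)
  + destruct m as [|[|m]]; [congruence|congruence|lia].
  + destruct m as [|[|m]]; [lia|lia|reflexivity].
- unfold point, upd; destruct n as [|[|n]]; [lia|lia|reflexivity].
- unfold point, upd; destruct n as [|[|n]]; [lia|lia|reflexivity].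
Qed.

Lemma times_upd (t : nat -> R) (n : nat) (s : R) :
  times t -> (2 <= n)%nat -> times (upd t n s).
Proof.
intros [T0 [T1 [N HN]]] Hn; unfold times, upd; repeat split.
- destruct n; [lia|exact T0].
- destruct n as [|[|n]]; [lia|lia|exact T1].
- exists (N + n + 1)%nat; intros m Hm.
  destruct (Nat.eqb_spec m n); [lia|apply HN; lia].
Qed.

Lemma smooth_in_time_C1_path (t : nat -> R) (n : nat) (h : (nat -> R) -> R) :
  times t -> (2 <= n)%nat -> smooth_in_time h ->
  exists h', C1_path (fun s => h (upd t n s)) h'.
Proof.
intros Ht Hn Hh.
pose proof (smooth_slice_C1 t n _ Hn (proj2 (proj2 Ht)) Hh) as H.
rewrite (slice_times t n (fun t _ _ => h t) Ht Hn) in H.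
(* The path is viewed as a family constant in the plane, so any base point would do in place of the
   origin. *)
exists (fun s => slice t n (partial n (fun p => h (times_of p))) s 0 0).
split; [intros s; apply (C1_s _ _ _ _ H s 0 0)|].
pose proof (C1_cont_s _ _ _ _ H); intros s; continuity.
Qed.

Lemma constant_of_zero_derivative (h : R -> R) :
  (forall s, is_derive h s 0) -> forall a b, h a = h b.
Proof.
intros Hh a b; destruct (Rtotal_order a b) as [L|[->|L]]; [|reflexivity|].
- apply (eq_is_derive h a b); auto.
- symmetry; apply (eq_is_derive h b a); auto.
Qed.

Definition coordinate (r : (nat -> R) -> R -> R -> vec) (c : ridx)
  (t : nat -> R) (x y : R) : R :=
  if snd c then Re (r t x y (fst c)) else Im (r t x y (fst c)).

Lemma cvec_coordinate (r : (nat -> R) -> R -> R -> vec) (t : nat -> R) (x y : R) :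
  cvec (fun c => coordinate r c t x y) = r t x y.
Proof.
apply functional_extensionality; intros k; symmetry; apply surjective_pairing.
Qed.

(** The deformation is restricted to the line on which only the time [t_n] moves and is written in
    six real coordinates, where the vanishing derivative of the energy integral applies. *)
Lemma area_upd_constant
  (w1_0 w2_0 : R * R) (f_0 : R -> R -> mat) (v_0 : R -> R -> R)
  (r_0 : R -> R -> vec)
  (w1 w2 : (nat -> R) -> R * R) (v : (nat -> R) -> R -> R -> R)
  (r : (nat -> R) -> R -> R -> vec) (t : nat -> R) (n : nat) :
  NV_deformation w1_0 w2_0 f_0 v_0 r_0 w1 w2 v r ->
  times t -> (2 <= n)%nat -> forall s s',
  area (w1 (upd t n s)) (w2 (upd t n s)) (fun x y => hopf (r (upd t n s) x y))
  = area (w1 (upd t n s')) (w2 (upd t n s'))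
      (fun x y => hopf (r (upd t n s') x y)).
Proof.
intros D Ht Hn.
destruct (nv_smooth_basis _ _ _ _ _ _ _ _ _ D) as [Sp [Sq [Su Sw]]].
destruct (smooth_in_time_C1_path t n _ Ht Hn Sp) as [p' Hp].
destruct (smooth_in_time_C1_path t n _ Ht Hn Sq) as [q' Hq].
destruct (smooth_in_time_C1_path t n _ Ht Hn Su) as [u' Hu].
destruct (smooth_in_time_C1_path t n _ Ht Hn Sw) as [w' Hw].
set (p := fun s => fst (w1 (upd t n s))) in *.
set (q := fun s => snd (w1 (upd t n s))) in *.
set (u := fun s => fst (w2 (upd t n s))) in *.
set (w := fun s => snd (w2 (upd t n s))) in *.
pose (g := fun c (p : nat -> R) => coordinate r c (times_of p) (p 0%nat) (p 1%nat)).
assert (Sg : forall c, smooth (g c)).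
{ intros [k []]; apply (nv_smooth _ _ _ _ _ _ _ _ _ D k). }
pose (d := fun m c => partial m (g c)).
assert (C : forall (h : ridx -> (nat -> R) -> R), (forall c, smooth (h c)) ->
  forall c, C1 (slice t n (h c)) (slice t n (partial n (h c)))
    (slice t n (partial 0 (h c))) (slice t n (partial 1 (h c))))
  by (intros h Hh c; apply smooth_slice_C1; auto; apply Ht).
pose proof (C g Sg) as H.
assert (Sd : forall m c, smooth (d m c)) by (intros; apply smooth_partial, Sg).
pose proof (C _ (Sd n)) as Hs.
pose proof (C _ (Sd 0%nat)) as Hx.
pose proof (C _ (Sd 1%nat)) as Hy.
pose (F := fun c => slice t n (g c)).
pose (Fx := fun c => slice t n (d 0%nat c)).
pose (Fy := fun c => slice t n (d 1%nat c)).
assert (EF : forall c s x y, F c s x y = coordinate r c (upd t n s) x y).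
{ intros c s x y; unfold F, g.
  rewrite (slice_times t n (coordinate r c) Ht Hn); reflexivity. }
assert (Er : forall s x y, cvec (at3 F s x y) = r (upd t n s) x y).
{ intros s x y; rewrite <- cvec_coordinate; unfold cvec, at3.
  apply functional_extensionality; intros k; rewrite !EF; reflexivity. }
assert (Dcx : forall c s x y,
  Derive (fun a => coordinate r c (upd t n s) a y) x = Fx c s x y).
{ intros c s x y; rewrite (Derive_ext _ (fun a => F c s a y))
    by (intros; symmetry; apply EF).
  apply is_derive_unique, (C1_x _ _ _ _ (H c)). }
assert (Dcy : forall c s x y,
  Derive (fun b => coordinate r c (upd t n s) x b) y = Fy c s x y).
{ intros c s x y; rewrite (Derive_ext _ (fun b => F c s x b))
    by (intros; symmetry; apply EF).
  apply is_derive_unique, (C1_y _ _ _ _ (H c)). }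
assert (Ex : forall s x y, cvec (at3 Fx s x y) = vDx (r (upd t n s)) x y).
{ intros s x y; apply functional_extensionality; intros k; unfold cvec, at3.
  rewrite <- !Dcx; reflexivity. }
assert (Ey : forall s x y, cvec (at3 Fy s x y) = vDy (r (upd t n s)) x y).
{ intros s x y; apply functional_extensionality; intros k; unfold cvec, at3.
  rewrite <- !Dcy; reflexivity. }
assert (Lift : forall s, lift_map (fun x y => hopf (r (upd t n s) x y))
  (v (upd t n s)) (r (upd t n s)))
  by (intros s; apply (nv_lift _ _ _ _ _ _ _ _ _ D), times_upd; auto).
assert (H1 : forall s x y,
  herm (cvec (at3 F s x y)) (cvec (at3 F s x y)) = RtoC 1)
  by (intros s x y; rewrite Er; apply (lift_sphere _ _ _ (Lift s))).
assert (HxF : forall s x y,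
  herm (cvec (at3 Fx s x y)) (cvec (at3 F s x y)) = RtoC 0)
  by (intros s x y; rewrite Ex, Er; apply (lift_x_r _ _ _ (Lift s))).
assert (HyF : forall s x y,
  herm (cvec (at3 Fy s x y)) (cvec (at3 F s x y)) = RtoC 0)
  by (intros s x y; rewrite Ey, Er; apply (lift_y_r _ _ _ (Lift s))).
assert (Dot : forall A B s x y, rdot A B s x y
  = Re (herm (cvec (at3 A s x y)) (cvec (at3 B s x y))))
  by (intros; rewrite Re_herm_cvec; reflexivity).
assert (Hxy : forall s x y, rdot Fx Fy s x y = 0)
  by (intros s x y; rewrite Dot, Ex, Ey, (lift_x_y _ _ _ (Lift s)); reflexivity).
assert (Hxx : forall s x y, rdot Fx Fx s x y = rdot Fy Fy s x y)
  by (intros s x y; rewrite !Dot, Ex, Ey, (lift_x_x _ _ _ (Lift s)),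
    (lift_y_y _ _ _ (Lift s)); reflexivity).
(* The potential is real, so [nv_L] splits into the same equation for the real and imaginary parts
   of each component. *)
assert (HV : forall c s x y, slice t n (partial 0 (d 0%nat c)) s x y
  + slice t n (partial 1 (d 1%nat c)) s x y
  + potential (v (upd t n s)) x y * F c s x y = 0).
{ intros c s x y.
  pose proof (nv_L _ _ _ _ _ _ _ _ _ D _ (times_upd t n s Ht Hn) x y (fst c)) as L.
  rewrite <- (is_derive_unique _ _ _ (C1_x _ _ _ _ (Hx c) s x y)),
    <- (is_derive_unique _ _ _ (C1_y _ _ _ _ (Hy c) s x y)), EF.
  rewrite (Derive_ext _ (fun a =>
    Derive (fun a => coordinate r c (upd t n s) a y) a)) by (intros; symmetry; apply Dcx).
  rewrite (Derive_ext (fun b => slice t n (d 1%nat c) s x b) (fun b =>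
    Derive (fun b => coordinate r c (upd t n s) x b) b)) by (intros; symmetry; apply Dcy).
  destruct c as [k []].
  - apply (f_equal Re) in L; refine (eq_trans _ L).
    unfold Schrodinger, Laplacian, Dx, Dy, DeriveC, coordinate, Re, Im; simpl; ring.
  - apply (f_equal Im) in L; refine (eq_trans _ L).
    unfold Schrodinger, Laplacian, Dx, Dy, DeriveC, coordinate, Re, Im; simpl; ring. }
assert (Hper : forall s x y i j,
  hopf (cvec (at3 F s (x + p s) (y + q s))) i j = hopf (cvec (at3 F s x y)) i j /\
  hopf (cvec (at3 F s (x + u s) (y + w s))) i j = hopf (cvec (at3 F s x y)) i j).
{ intros s x y i j; rewrite !Er.
  apply (mlt_periodic _ _ _
    (nv_torus _ _ _ _ _ _ _ _ _ D _ (times_upd t n s Ht Hn))). }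
pose proof (is_derive_moving_torus_energy F _ _ _ _ _ _ _ _ _ _ _ _
  (fun s => potential (v (upd t n s))) p p' q q' u u' w w' H Hs Hx Hy
  Hp Hq Hu Hw HV H1 HxF HyF Hxy Hxx Hper) as Z.
(* The energy is nonnegative, so the absolute value of the cross product can be taken outside the
   integral. Inside it remains the signed quantity whose derivative [Z] computes. *)
assert (A : forall s,
  area (w1 (upd t n s)) (w2 (upd t n s)) (fun x y => hopf (r (upd t n s) x y))
  = Rabs (RInt (fun a => RInt (fun b => (p s * w s - q s * u s) *
      energy Fx Fy s (a * p s + b * u s) (a * q s + b * w s)) 0 1) 0 1)).
{ intros s.
  assert (CE : continuous3 (energy Fx Fy))
    by exact (C1_cont _ _ _ _ (C1_energy _ _ _ _ _ _ _ _ Hx Hy)).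
  set (e := fun a b => energy Fx Fy s (a * p s + b * u s) (a * q s + b * w s)).
  assert (Ce : forall a b, continuous (fun z : R * R => e (fst z) (snd z)) (a, b))
    by (intros; unfold e; continuity).
  assert (I2 : forall a, ex_RInt (e a) 0 1)
    by (intros a; apply ex_RInt_continuous_everywhere; intros b; unfold e; continuity).
  assert (I1 : ex_RInt (fun a => RInt (e a) 0 1) 0 1).
  { apply ex_RInt_continuous_everywhere; intros a.
    apply continuous_RInt_param; intros; [apply Ce|unfold e; continuity]. }
  assert (G : forall a b, 0 <= e a b /\ sqrt (gdet (fun x y => hopf (r (upd t n s) x y))
    (a * p s + b * u s) (a * q s + b * w s)) = e a b).
  { intros a b.
    replace (fun x y => hopf (r (upd t n s) x y))
      with (fun x y => hopf (cvec (at3 F s x y)))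
      by (apply functional_extensionality; intros x;
          apply functional_extensionality; intros y; rewrite Er; reflexivity).
    exact (sqrt_gdet_hopf F _ Fx Fy s _ _ H (H1 _ _ _) (HxF _ _ _) (HyF _ _ _)
      (Hxy _ _ _) (Hxx _ _ _)). }
  unfold area, cross; fold (p s) (q s) (u s) (w s).
  transitivity (Rabs ((p s * w s - q s * u s) * RInt (fun a => RInt (e a) 0 1) 0 1)).
  - rewrite Rabs_mult, (Rabs_pos_eq (RInt _ _ _)).
    + f_equal; apply RInt_ext; intros a _; apply RInt_ext; intros b _; apply G.
    + apply RInt_ge_0; [lra|exact I1|]; intros a _.
      apply RInt_ge_0; [lra|apply I2|]; intros b _; apply G.
  - f_equal; transitivity (RInt (fun a =>
      (p s * w s - q s * u s) * RInt (e a) 0 1) 0 1).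
    + symmetry; exact (RInt_scal _ 0 1 _ I1).
    + apply RInt_ext; intros a _; symmetry; exact (RInt_scal _ 0 1 _ (I2 a)). }
intros s s'; rewrite !A; f_equal.
exact (constant_of_zero_derivative _ Z s s').
Qed.

Theorem corollary1
  (w1 w2 : R * R) (f : R -> R -> mat) (v : R -> R -> R) (r : R -> R -> vec)
  (tw1 tw2 : (nat -> R) -> R * R) (tv : (nat -> R) -> R -> R -> R)
  (tr : (nat -> R) -> R -> R -> vec)
  (Hf : minimal_Lagrangian_torus w1 w2 f)
  (Hv : Tzitzeica v)
  (Hr : lift_map f v r)
  (Hdef : NV_deformation w1 w2 f v r tw1 tw2 tv tr) :
  forall t, times t ->
    area (tw1 t) (tw2 t) (fun x y => hopf (tr t x y)) = area w1 w2 f.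
Proof.
assert (E0 : area (tw1 time0) (tw2 time0) (fun x y => hopf (tr time0 x y))
  = area w1 w2 f).
{ destruct (nv_init_basis _ _ _ _ _ _ _ _ _ Hdef) as [-> ->]; f_equal.
  repeat (apply functional_extensionality; intro).
  rewrite <- (lift_hopf _ _ _ Hr); unfold hopf.
  rewrite !(nv_init_r _ _ _ _ _ _ _ _ _ Hdef); reflexivity. }
(* Induction on a bound [N] for the support of the time vector. *)
assert (I : forall N t, times t -> (forall n, (N <= n)%nat -> t n = 0) ->
  area (tw1 t) (tw2 t) (fun x y => hopf (tr t x y)) = area w1 w2 f).
{ induction N as [|N IH]; intros t Ht HN.
  - replace t with time0; [exact E0|].
    apply functional_extensionality; intros n; symmetry; apply HN; lia.
  (* The indices [0] and [1] are not times and already carry the value zero; from [2] on, the entry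
     [t N] is moved to zero. *)
  - destruct (Nat.lt_ge_cases N 2) as [L|L].
    + apply IH; [exact Ht|]; intros n Hn.
      destruct (Nat.eq_dec n N) as [->|]; [|apply HN; lia].
      destruct Ht as [T0 [T1 _]]; destruct N as [|[|N]]; [assumption..|lia].
    + assert (Et : upd t N (t N) = t).
      { apply functional_extensionality; intros n; unfold upd.
        destruct (Nat.eqb_spec n N) as [->|]; reflexivity. }
      pose proof (area_upd_constant _ _ _ _ _ _ _ _ _ t N Hdef Ht L (t N) 0) as A.
      rewrite Et in A; rewrite A.
      apply IH; [apply times_upd; assumption|].
      intros n Hn; unfold upd; destruct (Nat.eqb_spec n N); [reflexivity|].
      apply HN; lia. }
intros t Ht; destruct (proj2 (proj2 Ht)) as [N HN]; exact (I N t Ht HN).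
Qed.
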